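(* Let $\mathfrak{m}=(x_1,\dots,x_n)$ be the maximal monomial ideal of the polynomial ring $S=k[x_1,x_2,\dots,x_n]$. Then the syzygies of the modules $S/\mathfrak{m}^p$, $p>0$, are finitely generated; that is, for the family $\mathcal{F}_{\mathfrak{m}}$ of cellular resolutions of $S/\mathfrak{m}^p$, $p>0$, the syzygy representation $\sigma_t$ is finitely generated for every $t$.
   Context: $k$ is a field. A labelled cell complex $X$ is a regular CW-complex whose vertices carry monomials and each face $F$ carries the lcm $\mathbf{x}^{\mathbf{a}_F}$ of the labels of its vertices (the empty face has label $1$). The cellular complex of $X$ has $i$-th free module $\bigoplus_{\dim F=i-1}S(-\mathbf{a}_F)$ and differential $\partial(F)=\sum_{G\subset F}\mathrm{sign}(G,F)\,\mathbf{x}^{\mathbf{a}_F-\mathbf{a}_G}G$ (sum over facets $G$ of $F$); it is a cellular resolution supported on $X$ if its only nonzero homology is in degree $0$. $X_n^p$ is the labelled cell complex given by the Newton polytope of $\mathfrak{m}^p$ (the convex hull in $\mathbb{R}^n$ of the exponent vectors of the degree-$p$ monomials) subdivided by the hyperplanes $H_{i,j}=\{y\in\mathbb{R}^n: y_i=j\}$, $0<i\le n$, $j\ge 0$, each vertex being labelled by the monomial with that exponent vector. It supports a cellular resolution $F_p$ of $S/\mathfrak{m}^p$. $\mathcal{F}_{\mathfrak{m}}$ is the category with objects $F_p$, $p>0$, and with morphisms $F_p\to F_{q}$ the multiplications by monomials of degree $q-p$, one morphism for each chain map: multiplication by $m=\mathbf{x}^{\mathbf{c}}$ is the pair consisting of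 the embedding $X_n^p\to X_n^q$, $y\mapsto y+\mathbf{c}$, and the corresponding chain map, which is multiplication by $m$ on the free module $S$ in degree $0$ and sends the generator of a cell to the generator of its image cell. The morphisms between consecutive resolutions are the multiplications by variables, and all other morphisms between different resolutions are compositions of these. A representation of a category $\mathcal{F}$ is a functor $M:\mathcal{F}\to\mathrm{Mod}_S$. It is finitely generated if there is a finite set of elements of the modules $M(F)$ such that the smallest subrepresentation (subfunctor) of $M$ containing them is $M$. The $t$-th syzygy representation $\sigma_t$ sends $F$ to its $t$-th syzygy module, taken here as the submodule $\mathrm{im}(d_{t+1})$ of the $t$-th free module of $F$ ($d_{t+1}$ the differential from homological degree $t+1$ to $t$), and sends a morphism to the restriction of its chain map. *)

(* Defs.v *)
From HB Require Import structures.
From mathcomp Require Import all_boot all_order all_algebra.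
From mathcomp Require Import finmap monalg mpoly.
From mathcomp Require Import boolp classical_sets functions cardinality fsbigop.
From mathcomp Require Import reals.

Set Implicit Arguments.
Unset Strict Implicit.
Unset Printing Implicit Defensive.

Import Order.TTheory GRing.Theory Num.Theory.

Local Open Scope classical_set_scope.
Local Open Scope ring_scope.

Section Polyhedra.
Variables (R : realType) (n : nat).
Local Notation V := 'rV[R]_n.

Definition conv_hull (A : set V) : set V :=
  [set y | exists (m : nat) (v : 'I_m -> V) (w : 'I_m -> R),
    [/\ forall j, A (v j), forall j, 0 <= w j, \sum_j w j = 1
      & y = \sum_j w j *: v j]].

Definition dot (a y : V) : R := \sum_i a 0 i * y 0 i.

(* The faces cut out by valid inequalities; both P and the empty set occur. *)
Definition face (P F : set V) : Prop :=
  exists (a : V) (b : R),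
    (forall y, P y -> dot a y <= b) /\ F = P `&` [set y | dot a y = b].

Definition side (s : comparison) (t : R) : Prop :=
  match s with Lt => t <= 0 | Eq => t = 0 | Gt => 0 <= t end.

(* The subdivision of the polytope P by the hyperplanes h i = 0: the common
   refinement of the face complex of P and of the complexes
   {h i <= 0, h i = 0, h i >= 0}.  The empty set is one of the cells. *)
Definition subdivision (P : set V) (I : Type) (h : I -> V -> R) :
    set (set V) :=
  [set C | exists (F : set V) (s : I -> comparison),
    face P F /\ C = F `&` [set y | forall i, side (s i) (h i y)]].

(* C contains m affinely independent points. *)
Definition aff_pts (C : set V) (m : nat) : Prop :=
  exists A : 'M[R]_(m, n),
    row_free (row_mx A (const_mx 1 : 'cV[R]_m)) /\ forall j, C (row j A).

(* dim C = i - 1; in particular the empty set has dimension -1. *)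
Definition has_dim1 (C : set V) (i : nat) : Prop :=
  aff_pts C i /\ ~ aff_pts C i.+1.

(* B is a basis of the direction space of C (where dim C = d). *)
Definition direction_basis d (C : set V) (B : 'M[R]_(d, n)) : Prop :=
  row_free B /\ forall x y, C x -> C y -> (x - y <= B)%MS.

(* A vector pointing from the face F to the outside across its facet G. *)
Definition outward (G F : set V) : V :=
  xget 0 [set v | exists x y, [/\ G x, F y, ~ G y & v = x - y]].

(* The incidence number of the facet G of F, where dim G = i - 1 and dim F = i,
   for cells oriented by the ordered bases o of their direction spaces
   ("outward normal first"); the augmentation takes every vertex to +1. *)
Definition incidence (o : forall d, set V -> 'M[R]_(d, n)) (i : nat)
    (G F : set V) : int :=
  match i with
  | 0%N => 1
  | d.+1 => sgz (\det ((col_mx (outward G F) (o d G) : 'M[R]_(d.+1, n))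
                       *m pinvmx (o d.+1 F)))
  end.

End Polyhedra.

(* A polyhedral complex in R^n, given by its cells (the empty one included),
   with a monomial on each vertex.  vlabel is only meaningful on vertices. *)
Record labelled_complex (R : realType) (n : nat) := LabelledComplex {
  cells : set (set 'rV[R]_n);
  vlabel : 'rV[R]_n -> 'X_{1..n}
}.

Section LinearExtension.
Variables (S : nzRingType) (K : choiceType) (M : lmodType S) (f : K -> M).

Local Notation msupp := monalg.msupp.
Local Notation mcoeff := monalg.mcoeff.

Definition lin_ext (g : {malg S[K]}) : M := \sum_(x <- msupp g) mcoeff x g *: f x.

Lemma lin_extEw (d : {fset K}) (g : {malg S[K]}) : fsubset (msupp g) d ->
  lin_ext g = \sum_(x <- d) mcoeff x g *: f x.
Proof.
move=> le; rewrite /lin_ext (big_fset_incl _ le) //= => x _ /monalg.mcoeff_outdom ->.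
by rewrite scale0r.
Qed.

Lemma lin_ext_is_linear : linear lin_ext.
Proof.
move=> a g h.
pose d := (msupp g `|` msupp h `|` msupp (a *: g + h))%fset.
rewrite (@lin_extEw d (a *: g + h)) ?fsubsetUr //.
rewrite (@lin_extEw d g); last by rewrite /d -fsetUA fsubsetUl.
rewrite (@lin_extEw d h); last by rewrite /d fsetUAC fsubsetUr.
rewrite scaler_sumr -big_split /=; apply: eq_bigr => x _.
by rewrite monalg.mcoeffD monalg.mcoeffZ scalerDl scalerA.
Qed.

HB.instance Definition _ :=
  GRing.isLinear.Build S {malg S[K]} M _ lin_ext lin_ext_is_linear.

Lemma lin_extU a x : lin_ext << a *g x >> = a *: f x.
Proof. by rewrite (lin_extEw (@monalg.msuppU_le _ _ _ _)) big_seq_fset1 monalg.mcoeffUU. Qed.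

End LinearExtension.

Section MalgLemmas.
Variables (S : nzRingType) (K : choiceType).

Lemma scale_malgU (a b : S) (x : K) : a *: << b *g x >> = << (a * b) *g x >>.
Proof.
apply/malgP => y; rewrite monalg.mcoeffZ !monalg.mcoeffU.
by case: (x == y); rewrite ?mulr1n ?mulr0n ?mulr0.
Qed.

Lemma malgU_inj (a b : S) (x : K) : << a *g x >> = << b *g x >> -> a = b.
Proof. by move/(congr1 (monalg.mcoeff x)); rewrite !monalg.mcoeffUU. Qed.

Lemma eq_linear_gen (M : lmodType S) (f g : {linear {malg S[K]} -> M}) :
  (forall x, f << x >> = g << x >>) -> f =1 g.
Proof.
move=> fg u; rewrite [u]monalg.monalgE !linear_sum; apply: eq_bigr => x _.
by rewrite -[monalg.mcoeff x u]mulr1 -scale_malgU !linearZ /= fg.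
Qed.

End MalgLemmas.

Section CellularComplex.
Variables (k : fieldType) (R : realType) (n : nat).
Variable X : labelled_complex R n.
Variable o : forall d, set 'rV[R]_n -> 'M[R]_(d, n).

Definition face_label (F : set 'rV[R]_n) : 'X_{1..n} :=
  \big[@mlcm n/0%MM]_(v \in [set v | cells X [set v] /\ F v]) vlabel X v.

Definition cell_of_dim1 (i : nat) : {pred set 'rV[R]_n} :=
  fun C => `[< cells X C /\ has_dim1 C i >].

(* The generators of the i-th free module: the cells of dimension i - 1. *)
Definition cell_type (i : nat) : Type := {C | cell_of_dim1 i C}.
HB.instance Definition _ i := Choice.on (cell_type i).

(* The types force dim G = dim F - 1. *)
Definition facets (i : nat) (F : cell_type i.+1) : set (cell_type i) :=
  [set G | val G `<=` val F].

Local Notation S := {mpoly k[n]}.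
Local Notation free_module i := {malg S[cell_type i]}.

(* The sums over faces are finite on Xnp, by cells_finite below. *)
Definition diff_gen (i : nat) (F : cell_type i.+1) : free_module i :=
  \sum_(G \in facets F)
     << ((incidence o i (val G) (val F))%:~R
         * 'X_[face_label (val F) - face_label (val G)] : S) *g G >>.

Definition diff (i : nat) : {linear free_module i.+1 -> free_module i} :=
  lin_ext (@diff_gen i).

End CellularComplex.

Section Image.
Variables (S : nzRingType) (U M : lmodType S) (f : {linear U -> M}).

Definition im_pred : {pred M} := fun x => `[< exists u, f u = x >].

Lemma im_submod_closed : submod_closed im_pred.
Proof.
split=> [|a x y]; first by apply/asboolP; exists 0; rewrite linear0.
move=> /asboolP[u <-] /asboolP[v <-]; apply/asboolP; exists (a *: u + v).
by rewrite linearP.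
Qed.

HB.instance Definition _ :=
  GRing.isSubmodClosed.Build S M im_pred im_submod_closed.

Definition image_module : Type := {x | im_pred x}.
HB.instance Definition _ := [isSub of image_module for @sval _ _].
HB.instance Definition _ := [Choice of image_module by <:].
HB.instance Definition _ := [SubChoice_isSubLmodule of image_module by <:].

End Image.

Section Subdivided.
Variables (R : realType) (n : nat).
Local Notation V := 'rV[R]_n.

Definition exp_vec (m : 'X_{1..n}) : V := \row_i (m i)%:R.

Definition newton (p : nat) : set V :=
  conv_hull [set exp_vec m | m in [set m | mdeg m = p]].

Definition Xnp (p : nat) : labelled_complex R n := {|
  cells := subdivision (newton p)
    (fun (ij : 'I_n * nat) (y : V) => y 0 ij.1 - ij.2%:R);
  (* on a lattice point this is the monomial with that exponent vector *)
  vlabel := fun y => [multinom Num.truncn (y 0%R i) | i < n] |}.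

Definition translate (c : 'X_{1..n}) (C : set V) : set V :=
  [set y + exp_vec c | y in C].

Definition simplex (p : nat) : set V :=
  [set y | (forall i, 0 <= y 0 i) /\ \sum_i y 0 i = p%:R].

Lemma newtonE p : newton p = simplex p.
Proof.
apply/seteqP; split=> y /=.
  move=> [m [v [w [vA w0 w1 ->]]]].
  have vP j : simplex p (v j).
    have [e /= dege <-] := vA j; split=> [i|]; first by rewrite mxE ler0n.
    under eq_bigr do rewrite mxE.
    by rewrite -natr_sum -mdegE dege.
  split=> [i|].
    rewrite summxE sumr_ge0 // => j _; rewrite mxE mulr_ge0 //.
    by case: (vP j).
  under eq_bigr do rewrite summxE.
  rewrite exchange_big /=.
  transitivity (\sum_j w j * p%:R); last by rewrite -mulr_suml w1 mul1r.
  apply: eq_bigr => j _; under eq_bigr do rewrite mxE.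
  by rewrite -mulr_sumr; case: (vP j) => _ ->.
move=> [y0 ysum].
have [p0|p_gt0] := posnP p.
  exists 1%N, (fun=> exp_vec 0%MM), (fun=> 1); split=> [j|j||].
  - by exists 0%MM => //=; rewrite mdeg0 p0.
  - exact: ler01.
  - by rewrite big_ord1.
  - rewrite big_ord1 scale1r; apply/rowP=> i; rewrite mxE mnm0E.
    move: ysum; rewrite p0 => /eqP; rewrite psumr_eq0 //.
    by move=> /allP/(_ i (mem_index_enum _))/implyP/(_ isT)/eqP.
have p_neq0 : p%:R != 0 :> R by rewrite pnatr_eq0 -lt0n.
exists n, (fun i => exp_vec (U_(i) *+ p)%MM), (fun i => y 0 i / p%:R).
split=> [j|j||].
- by exists (U_(j) *+ p)%MM => //=; rewrite mdegMn mdeg1 mul1n.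
- by rewrite divr_ge0 ?ler0n.
- by rewrite -mulr_suml ysum divff.
- apply/rowP=> i; rewrite summxE (bigD1 i) //= big1 ?addr0.
    by rewrite !mxE mulmnE mnm1E eqxx mul1n divfK.
  by move=> j ji; rewrite !mxE mulmnE mnm1E (negbTE ji) mul0n mulr0.
Qed.

Lemma face_simplex p F : (0 < p)%N -> face (simplex p) F ->
  F = set0 \/
  exists Z : pred 'I_n, F = simplex p `&` [set y | forall i, Z i -> y 0 i = 0].
Proof.
move=> p_gt0 [a [b [ab ->]]].
have [/nonemptyPn ->|] := pselect (~ ((simplex p `&` [set y | dot a y = b]) !=set0)).
  by left.
move=> /contrapT[y0 [y0P y0b]]; right.
have vP i : simplex p (exp_vec (U_(i) *+ p)%MM).
  rewrite -newtonE; exists 1%N, (fun=> exp_vec (U_(i) *+ p)%MM), (fun=> 1).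
  split=> [j|j||]; rewrite ?big_ord1 ?scale1r //.
  by exists (U_(i) *+ p)%MM => //=; rewrite mdegMn mdeg1 mul1n.
have le_b i : p%:R * a 0 i <= b.
  have := ab _ (vP i); rewrite /dot (bigD1 i) //= big1 ?addr0 => [|j ji].
    by rewrite mxE mulmnE mnm1E eqxx mul1n mulrC.
  by rewrite mxE mulmnE mnm1E eq_sym (negbTE ji) mul0n mulr0.
exists (fun i => p%:R * a 0 i < b); apply/seteqP; split=> y /= [[y0' ysum] yb].
  split=> // i lt_ib.
  have : \sum_i y 0 i * (b - p%:R * a 0 i) = 0.
    under eq_bigr do rewrite mulrBr mulrCA [y 0 _ * a 0 _]mulrC.
    by rewrite sumrB -mulr_suml -mulr_sumr ysum -/(dot a y) yb subrr.
  move/eqP; rewrite psumr_eq0 => [|j _]; last by rewrite mulr_ge0 ?subr_ge0.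
  move=> /allP/(_ i (mem_index_enum _))/implyP/(_ isT).
  by rewrite mulf_eq0 subr_eq0 [b == _]gt_eqF // orbF => /eqP.
split=> //.
have : \sum_i y 0 i * (b - p%:R * a 0 i) = 0.
  apply: big1 => i _; have := le_b i; rewrite le_eqVlt => /orP[/eqP <-|lt_ib].
    by rewrite subrr mulr0.
  by rewrite yb ?mul0r.
under eq_bigr do rewrite mulrBr mulrCA [y 0 _ * a 0 _]mulrC.
rewrite sumrB -mulr_suml -mulr_sumr ysum -/(dot a y) -mulrBr => /eqP.
by rewrite mulf_eq0 pnatr_eq0 (gtn_eqF p_gt0) /= subr_eq0 => /eqP.
Qed.

Local Notation sides s := [set y : V | forall ij : 'I_n * nat,
  side (s ij) (y 0 ij.1 - ij.2%:R)].

Lemma cellP p C : (0 < p)%N ->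
  cells (Xnp p) C <->
  C = set0 \/ exists s : 'I_n * nat -> comparison, C = simplex p `&` sides s.
Proof.
move=> p_gt0; rewrite /= newtonE; split.
  move=> [F [s [/(face_simplex p_gt0)[->|[Z ->]] ->]]].
    by left; rewrite set0I.
  right; exists (fun ij => if (ij.2 == 0%N) && Z ij.1 then Eq else s ij).
  apply/seteqP; split=> y /=.
    move=> [[yP yZ] ys]; split=> // -[i j]; case: ifP => // /andP[/eqP /= -> Zi].
    by rewrite yZ // subrr.
  move=> [yP ys].
  have yZ i : Z i -> y 0 i = 0 by move=> Zi; have /= := ys (i, 0%N); rewrite Zi /= subr0.
  split=> // -[i j]; have := ys (i, j); case: ifP => //=.
  move=> /andP[/eqP -> Zi] _; rewrite yZ // subrr; by case: (s _) => /=.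
move=> [->|[s ->]].
  exists set0, (fun=> Eq); split; last by rewrite set0I.
  exists 0, 1; have d0 y : @dot R n 0 y = 0.
    by rewrite /dot big1 // => i _; rewrite mxE mul0r.
  split=> [y _|]; first by rewrite d0 ler01.
  by apply/seteqP; split=> y //= [_]; rewrite d0 => /esym/eqP; rewrite oner_eq0.
exists (simplex p), s; split=> //.
exists 0, 0; have d0 y : @dot R n 0 y = 0.
  by rewrite /dot big1 // => i _; rewrite mxE mul0r.
split=> [y _|]; first by rewrite d0.
by apply/seteqP; split=> [y ?|y []//]; split => //=.
Qed.

Lemma cell_sub p C : (0 < p)%N -> cells (Xnp p) C -> C `<=` simplex p.
Proof. by move=> p_gt0 /cellP-/(_ p_gt0)[->//|[s ->]] y []. Qed.

Lemma cell0 p : (0 < p)%N -> cells (Xnp p) set0.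
Proof. by move=> p_gt0; apply/cellP => //; left. Qed.

Lemma exp_vecD c d : exp_vec (c + d)%MM = exp_vec c + exp_vec d.
Proof. by apply/rowP=> i; rewrite !mxE mnmDE natrD. Qed.

Lemma exp_vec0 : exp_vec 0%MM = 0.
Proof. by apply/rowP=> i; rewrite !mxE mnm0E. Qed.

Lemma translateE c C : translate c C = [set y | C (y - exp_vec c)].
Proof.
apply/seteqP; split=> y /=; first by move=> [z Cz <-]; rewrite addrK.
by move=> Cy; exists (y - exp_vec c) => //; rewrite subrK.
Qed.

Lemma translateD c d C : translate c (translate d C) = translate (c + d)%MM C.
Proof.
by rewrite !translateE; apply/seteqP; split=> y /=;
  rewrite exp_vecD opprD addrA.
Qed.

Lemma translate0 C : translate 0%MM C = C.
Proof. by rewrite translateE exp_vec0; apply/seteqP; split=> y /=; rewrite subr0. Qed.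

Lemma translate_eq0 c : translate c set0 = set0.
Proof. by rewrite /translate image_set0. Qed.

Lemma translate_inj c : injective (translate c).
Proof.
move=> C D; rewrite !translateE => /seteqP[CD DC]; apply/seteqP; split=> y yC.
  by have := CD (y + exp_vec c); rewrite /= addrK; apply.
by have := DC (y + exp_vec c); rewrite /= addrK; apply.
Qed.

Lemma translate_sub c C D : translate c C `<=` translate c D <-> C `<=` D.
Proof.
rewrite !translateE; split=> CD y /= => [yC|/CD//].
by have := CD (y + exp_vec c); rewrite /= addrK; apply.
Qed.

Lemma simplexD p q (c : 'X_{1..n}) (y : V) : (mdeg c + p)%N = q -> (forall i, (c i)%:R <= y 0 i) ->
  simplex q y <-> simplex p (y - exp_vec c).
Proof.
move=> <- cy; have sumE : \sum_i (y - exp_vec c) 0 i = \sum_i y 0 i - (mdeg c)%:R.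
  by under eq_bigr do rewrite !mxE; rewrite sumrB mdegE natr_sum.
split=> -[y0 ys]; split.
- by move=> i; rewrite !mxE subr_ge0.
- by rewrite sumE ys natrD addrC addKr.
- by move=> i; apply: le_trans (cy i); rewrite ler0n.
- by move: ys; rewrite sumE => /eqP; rewrite subr_eq -natrD addnC => /eqP.
Qed.

Lemma simplex_le p (c : 'X_{1..n}) (y : V) : simplex p (y - exp_vec c) -> forall i, (c i)%:R <= y 0 i.
Proof. by move=> [y0 _] i; have := y0 i; rewrite !mxE subr_ge0. Qed.

Lemma cell_translate p q c C : (0 < p)%N -> (mdeg c + p)%N = q ->
  cells (Xnp p) C -> cells (Xnp q) (translate c C).
Proof.
move=> p_gt0 cpq /cellP-/(_ p_gt0) Ccell.
have q_gt0 : (0 < q)%N by rewrite -cpq addn_gt0 p_gt0 orbT.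
apply/cellP => //; case: Ccell => [->|[s ->]]; first by left; exact: translate_eq0.
right; exists (fun ij => if (ij.2 < c ij.1)%N then Gt
  else if ij.2 == c ij.1 then (if s (ij.1, 0%N) is Gt then Gt else Eq)
  else s (ij.1, ij.2 - c ij.1)%N).
rewrite translateE; apply/seteqP; split=> y /=.
  move=> [yP ys]; have cy := simplex_le yP.
  split; first exact/(simplexD cpq).
  move=> [i j] /=; case: ltngtP => [ji|ij|eij] /=.
  - by rewrite subr_ge0 (le_trans _ (cy i)) // ler_nat ltnW.
  - have := ys (i, j - c i)%N; rewrite /= !mxE natrB ?(ltnW ij) //.
    by rewrite opprB addrA subrK.
  - have := ys (i, 0%N); rewrite /= eij !mxE subr0.
    case: (s _) => //= h; apply/le_anti; rewrite h subr_ge0; exact: cy.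
move=> [yP ys].
have cy i : (c i)%:R <= y 0 i.
  have := ys (i, c i); rewrite /= ltnn eqxx; case: (s _) => /= h;
  by rewrite -subr_ge0 ?h.
split; first exact/(simplexD cpq).
move=> [i j] /=; have := ys (i, j + c i)%N => /=.
have -> : (j + c i == c i)%N = (j == 0%N) by rewrite -{2}[c i]add0n eqn_add2r.
rewrite /= ltnNge leq_addl /= addnK !mxE natrD opprD addrA addrAC.
case: eqP => [-> /=|//].
have := cy i; rewrite -subr_ge0 subr0.
by case: (s _) => //= h0 h; rewrite h.
Qed.

Lemma cell_untranslate p q c C : (0 < p)%N -> (mdeg c + p)%N = q ->
  C `<=` simplex p -> cells (Xnp q) (translate c C) -> cells (Xnp p) C.
Proof.
move=> p_gt0 cpq CP.
have q_gt0 : (0 < q)%N by rewrite -cpq addn_gt0 p_gt0 orbT.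
move=> /cellP-/(_ q_gt0) Ccell; apply/cellP => //.
have [/nonemptyPn ->|] := pselect (~ (C !=set0)); first by left.
move=> /contrapT[y0 Cy0]; right.
case: Ccell => [|[s]]; rewrite translateE.
  by move=> /seteqP[/(_ (y0 + exp_vec c))]; rewrite /= addrK => /(_ Cy0).
move=> CE.
have CE' y : C y <-> simplex q (y + exp_vec c) /\ forall ij : 'I_n * nat,
    side (s ij) ((y + exp_vec c) 0 ij.1 - ij.2%:R).
  have := congr1 (fun A : set V => A (y + exp_vec c)) CE.
  by rewrite /= addrK => ->.
exists (fun ij => s (ij.1, ij.2 + c ij.1)%N).
have addE (y : V) i j : (y + exp_vec c) 0 i - (j + c i)%:R = y 0 i - j%:R.
  by rewrite !mxE natrD opprD addrACA addrAC subrr addr0 addrC.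
apply/seteqP; split=> y /=.
  move=> Cy; split; first exact: CP.
  by move=> [i j]; have [_ /(_ (i, j + c i)%N)] := (CE' y).1 Cy; rewrite addE.
move=> [yP ys]; apply/CE'; split.
  by apply/(simplexD cpq) => [i|]; rewrite ?addrK // !mxE lerDr; case: yP.
move=> [i j] /=; have [ji|ij] := ltnP j (c i); last first.
  by have := ys (i, j - c i)%N; rewrite /= -addE subnK.
have := ((CE' y0).1 Cy0).2 (i, j); have [y00 _] := CP _ Cy0; have [yy _] := yP.
have jlt : j%:R < (c i)%:R :> R by rewrite ltr_nat.
have gt0 (z : V) : 0 <= z 0 i -> 0 < (z + exp_vec c) 0 i - j%:R.
  by move=> z0; rewrite subr_gt0 !mxE (lt_le_trans jlt) // lerDr.
have := gt0 _ (y00 i); have := gt0 _ (yy i).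
case: (s _) => /= h h'.
- by move=> h0; rewrite h0 ltxx in h'.
- by move=> h0; rewrite ltNge h0 in h'.
- by move=> _; exact: ltW.
Qed.

Lemma aff_pts_shift (C : set V) (v : V) m :
  aff_pts C m -> aff_pts [set y | C (y - v)] m.
Proof.
move=> [A [Afree AC]]; exists (A + (const_mx 1 : 'cV_m) *m v); split; last first.
  move=> j /=; suff -> : row j (A + (const_mx 1 : 'cV_m) *m v) - v = row j A by [].
  by apply/rowP=> i; rewrite !mxE big_ord1 !mxE mul1r addrK.
suff -> : row_mx (A + (const_mx 1 : 'cV_m) *m v) (const_mx 1 : 'cV_m) =
    row_mx A (const_mx 1 : 'cV_m) *m block_mx 1%:M 0 v (1%:M : 'M_1).
  rewrite /row_free mxrankMfree //.
  by rewrite row_free_unit unitmxE det_lblock !det1 mul1r unitr1.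
by rewrite mul_row_block !mulmx1 mulmx0 add0r.
Qed.

Lemma aff_pts_translate c C m : aff_pts (translate c C) m <-> aff_pts C m.
Proof.
rewrite translateE; split=> [|/(@aff_pts_shift _ (exp_vec c))//].
move/(@aff_pts_shift _ (- exp_vec c)).
suff -> : [set y | [set y0 | C (y0 - exp_vec c)] (y - - exp_vec c)] = C by [].
by apply/seteqP; split=> y /=; rewrite opprK addrK.
Qed.

Lemma has_dim1_translate c C i : has_dim1 (translate c C) i <-> has_dim1 C i.
Proof. by rewrite /has_dim1 !aff_pts_translate. Qed.

Lemma has_dim1_eq0 (C : set V) : has_dim1 C 0 -> C = set0.
Proof.
move=> [_ no1]; apply/nonemptyPn => -[y Cy]; apply: no1; exists y.
split=> [|j]; last first.
  by suff -> : row j y = y by []; apply/rowP=> i; rewrite mxE ord1.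
rewrite /row_free rank_rV (_ : _ != 0) //; apply/eqP=> /(congr1 (@rsubmx R 1 n 1)).
by rewrite row_mxKr linear0 => /matrixP/(_ 0 0)/eqP; rewrite !mxE oner_eq0.
Qed.

Lemma has_dim1_neq0 (C : set V) i : has_dim1 C i.+1 -> C !=set0.
Proof. by move=> [[A [_ AC]] _]; exists (row 0 A). Qed.

Lemma between_sum (f g : 'I_n -> nat) d : (forall i, f i <= g i)%N ->
  (\sum_i f i + d <= \sum_i g i)%N ->
  exists m : 'X_{1..n}, [/\ forall i, (f i <= m i)%N, forall i, (m i <= g i)%N
    & mdeg m = (\sum_i f i + d)%N].
Proof.
move=> fg; elim: d => [_|d IH le_d].
  exists [multinom f i | i < n]; rewrite addn0 mdegE.
  by split=> [i|i|]; [rewrite mnmE|rewrite mnmE|apply: eq_bigr => i _; rewrite mnmE].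
have [|m [fm mg degm]] := IH; first by rewrite (leq_trans _ le_d) // leq_add2l.
have [i lt_i|ge] := pickP (fun i => m i < g i)%N.
  exists (m + U_(i))%MM; split=> [j|j|].
  - by rewrite mnmDE (leq_trans (fm j)) // leq_addr.
  - rewrite mnmDE mnm1E; case: eqP => [<-|_]; first by rewrite addn1.
    by rewrite addn0.
  - by rewrite mdegD mdeg1 degm addn1 addnS.
move: le_d; rewrite addnS -degm mdegE ltnNge leq_sum // => i _.
by rewrite leqNgt ge.
Qed.

Lemma cell_point p m : (0 < p)%N -> mdeg m = p -> cells (Xnp p) [set exp_vec m].
Proof.
move=> p_gt0 degm; apply/cellP => //; right.
exists (fun ij => if ij.2 == m ij.1 then Eq else
  if (ij.2 < m ij.1)%N then Gt else Lt).
apply/seteqP; split=> y /=.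
  move=> ->; split.
    split=> [i|]; first by rewrite mxE ler0n.
    by under eq_bigr do rewrite mxE; rewrite -natr_sum -mdegE degm.
  move=> [i j] /=; rewrite mxE; case: ltngtP => [ji|ij|->] /=.
  - by rewrite subr_ge0 ler_nat ltnW.
  - by rewrite subr_le0 ler_nat ltnW.
  - by rewrite subrr.
move=> [_ ys]; apply/rowP=> i; have := ys (i, m i).
by rewrite /= eqxx mxE => /eqP; rewrite subr_eq0 => /eqP.
Qed.

Lemma lattice_point p C : (0 < p)%N -> cells (Xnp p) C -> C !=set0 ->
  exists m, C (exp_vec m) /\ mdeg m = p.
Proof.
move=> p_gt0 /cellP-/(_ p_gt0)[->|[s ->]] [y //= [[y0 ysum] ys]].
pose f i := Num.truncn (y 0 i).
pose g i := (f i + ~~ (y 0 i <= (f i)%:R)%R)%N.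
have fy i : (f i)%:R <= y 0 i by rewrite truncn_le.
have yg i : y 0 i <= (g i)%:R.
  rewrite /g; case: (boolP (y 0 i <= (f i)%:R)) => [h|_] /=; first by rewrite addn0.
  by rewrite addn1; apply: ltW; have /andP[] := truncn_itv (y0 i).
have fp : (\sum_i f i <= p)%N.
  by rewrite -(ler_nat R) natr_sum -ysum ler_sum.
have pg : (p <= \sum_i g i)%N.
  by rewrite -(ler_nat R) natr_sum -ysum ler_sum.
have [i||m [fm mg degm]] := @between_sum f g (p - \sum_i f i); first exact: leq_addr.
  by rewrite subnKC.
rewrite subnKC // in degm.
have lo i j : (j%:R <= y 0 i) -> (j <= m i)%N.
  by rewrite -truncn_ge_nat // => h; apply: leq_trans h (fm i).
have hi i j : (y 0 i <= j%:R) -> (m i <= j)%N.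
  move=> h; apply: leq_trans (mg i) _; rewrite /g.
  have fj : (f i <= j)%N by rewrite -(ler_nat R) (le_trans (fy i)).
  case: (boolP (y 0 i <= (f i)%:R)) => [_|] /=; first by rewrite addn0.
  rewrite -ltNge => fy'; rewrite addn1.
  by rewrite -(ltr_nat R) (lt_le_trans fy').
exists m; split=> //; split.
  split=> [i|]; first by rewrite mxE ler0n.
  by under eq_bigr do rewrite mxE; rewrite -natr_sum -mdegE degm.
move=> [i j] /=; have := ys (i, j); rewrite mxE /=; case: (s _) => /=.
- move/eqP; rewrite subr_eq0 => /eqP yj; apply/eqP; rewrite subr_eq0 eqr_nat.
  by rewrite eqn_leq hi ?lo ?yj.
- by rewrite !subr_le0 ler_nat; apply: hi.
- by rewrite !subr_ge0 ler_nat; apply: lo.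
Qed.

Lemma cells_finite p : (0 < p)%N -> finite_set (cells (Xnp p)).
Proof.
move=> p_gt0.
pose dec (b : option bool) := match b with
  None => Eq | Some true => Gt | Some false => Lt end.
pose enc (s : comparison) := match s with
  Eq => None | Gt => Some true | Lt => Some false end.
have encK s : dec (enc s) = s by case: s.
pose cell_of (t : {ffun 'I_n * 'I_p.+1 -> option bool}) : set V :=
  simplex p `&` [set y | forall ij, side (dec (t ij)) (y 0 ij.1 - ij.2%:R)].
apply: (@sub_finite_set _ _ (set0 |` range cell_of)); last first.
  by rewrite finite_setU; split; [exact: finite_set1|exact/finite_image/finite_finset].
move=> C Ccell.
have [/nonemptyPn ->|/contrapT C0] := pselect (~ (C !=set0)); first by left.
have [m [Cm degm]] := lattice_point p_gt0 Ccell C0.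
move/cellP: Ccell => /(_ p_gt0)[|[s CE]]; first by left.
right; exists [ffun ij : 'I_n * 'I_p.+1 => enc (s (ij.1, val ij.2))] => //.
rewrite CE; apply/seteqP; split=> y /= [yP ys]; split=> //; last first.
  move=> [i j]; rewrite ffunE encK; exact: (ys (i, val j)).
move=> [i j]; have [jp|pj] := ltnP j p.+1.
  by have := ys (i, Ordinal jp); rewrite /= ffunE encK.
have lt_j z : simplex p z -> z 0 i - j%:R < 0.
  move=> [z0 zs]; rewrite subr_lt0 (@le_lt_trans _ _ p%:R) ?ltr_nat //.
  by rewrite -zs (bigD1 i) //= lerDl sumr_ge0.
move: Cm; rewrite CE => -[mP /(_ (i, j))] /=.
have := lt_j _ yP; have := lt_j _ mP; case: (s _) => /= h h'.
- by move=> h0; rewrite h0 ltxx in h.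
- by move=> _; exact: ltW.
- by move=> h0; rewrite ltNge h0 in h.
Qed.

Lemma mlcmA : associative (@mlcm n).
Proof. by move=> a b c; apply/mnmP=> i; rewrite !mnmE maxnA. Qed.

Lemma face_label_le p C m : (0 < p)%N ->
  (face_label (Xnp p) C <= m)%MM <->
  forall v, cells (Xnp p) [set v] -> C v -> (vlabel (Xnp p) v <= m)%MM.
Proof.
move=> p_gt0; rewrite /face_label.
pose law := HB.pack_for (Monoid.com_law 0%MM) (@mlcm n)
  (Monoid.isComLaw.Build _ 0%MM (@mlcm n) mlcmA (@mlcmC n) (@mlc0m n)).
have fin : finite_set [set v | cells (Xnp p) [set v] /\ C v].
  apply: (@sub_finite_set _ _ (set1 @^-1` cells (Xnp p))); first by move=> v [].
  apply: finite_preimage (cells_finite p_gt0) => u v _ _ /seteqP[uv _].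
  exact: (uv u).
rewrite (fsbig_finite law) //=; set r := fset_set _.
have -> (s : seq V) : (\big[@mlcm n/0%MM]_(v <- s) vlabel (Xnp p) v <= m)%MM <->
    forall v, v \in s -> (vlabel (Xnp p) v <= m)%MM.
  elim: s => [|v s IH].
    by rewrite big_nil; split=> // _; apply/mnm_lepP=> i; rewrite mnm0E.
  rewrite big_cons lem_mlcm; split.
    by move=> /andP[vm /IH sm] u; rewrite inE => /predU1P[->//|/sm].
  move=> sm; rewrite sm ?mem_head //=; apply/IH => u us.
  by apply: sm; rewrite inE us orbT.
split=> [h v cv Cv|h v]; first by apply: h; rewrite in_fset_set ?inE.
by rewrite in_fset_set ?inE // => -[]; apply: h.
Qed.

Lemma vlabelD p q c (v : V) : (forall i, 0 <= v 0 i) ->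
  vlabel (Xnp q) (v + exp_vec c) = (vlabel (Xnp p) v + c)%MM.
Proof.
move=> v0; apply/mnmP=> i; rewrite mnmDE !mnmE !mxE.
rewrite addrC truncnD; first by rewrite natrK addnC.
  exact: natr_nat.
by rewrite nnegrE.
Qed.

Lemma face_label_translate p q c C : (0 < p)%N -> (mdeg c + p)%N = q ->
  cells (Xnp p) C -> C !=set0 ->
  face_label (Xnp q) (translate c C) = (face_label (Xnp p) C + c)%MM.
Proof.
move=> p_gt0 cpq Ccell C0.
have q_gt0 : (0 < q)%N by rewrite -cpq addn_gt0 p_gt0 orbT.
have CP := cell_sub p_gt0 Ccell.
have [a [Ca dega]] := lattice_point p_gt0 Ccell C0.
have key m : (face_label (Xnp q) (translate c C) <= m)%MM <->
    (face_label (Xnp p) C + c <= m)%MM.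
  rewrite face_label_le //; split=> [h|h v cv]; last first.
    rewrite translateE => Cv; rewrite -[v](subrK (exp_vec c)).
    have vP := CP _ Cv; rewrite (@vlabelD p); last by case: vP.
    apply: lepm_trans h; apply/mnm_lepP=> i; rewrite !mnmDE leq_add2r.
    move: i; apply/mnm_lepP.
    apply: (iffLR (@face_label_le p C _ p_gt0) (lepm_refl _)) => //.
    apply: (@cell_untranslate p q c) => //; first by move=> _ ->.
    by rewrite /translate image_set1 subrK.
  have le_m v : cells (Xnp p) [set v] -> C v ->
      (vlabel (Xnp p) v + c <= m)%MM.
    move=> cv Cv; rewrite -(@vlabelD p q); last by case: (CP _ Cv).
    apply: h; last by exists v.
    by have := cell_translate p_gt0 cpq cv; rewrite /translate image_set1.
  have cm : (c <= m)%MM.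
    apply: lepm_trans (le_m _ (cell_point p_gt0 dega) Ca).
    exact: lem_addl.
  rewrite -(submK cm); apply/mnm_lepP=> i; rewrite 2!mnmDE leq_add2r.
  move: i; apply/mnm_lepP; apply/face_label_le => // v cv Cv.
  have /mnm_lepP le := le_m _ cv Cv; apply/mnm_lepP=> i.
  by have := le i; rewrite mnmBE mnmDE leq_subRL ?(mnm_lepP cm) // addnC.
have := (key (face_label (Xnp q) (translate c C))).1 (lepm_refl _).
have := (key (face_label (Xnp p) C + c)%MM).2 (lepm_refl _).
move=> /mnm_lepP h1 /mnm_lepP h2; apply/mnmP=> i; apply/eqP.
by rewrite eqn_leq h1 h2.
Qed.

Lemma face_label0 p : face_label (Xnp p) set0 = 0%MM.
Proof.
rewrite /face_label (_ : [set v | _ /\ _] = set0); last first.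
  by apply/seteqP; split=> v //= [].
pose law := HB.pack_for (Monoid.com_law 0%MM) (@mlcm n)
  (Monoid.isComLaw.Build _ 0%MM (@mlcm n) mlcmA (@mlcmC n) (@mlc0m n)).
by rewrite (fsbig_set0 law).
Qed.

Lemma outward_translate c G F :
  outward (translate c G) (translate c F) = outward G F.
Proof.
rewrite /outward; congr (xget _ _); rewrite !translateE.
apply/seteqP; split=> v /= [x [y [Gx Fy nGy ->]]].
  by exists (x - exp_vec c), (y - exp_vec c); split; rewrite // opprB addrA subrK.
by exists (x + exp_vec c), (y + exp_vec c); split; rewrite ?addrK // opprD addrACA subrr addr0.
Qed.

(* A choice of orientation of all cells, compatible with the embeddings
   y |-> y + c of X_n^p into X_n^q, so that these send generators to
   generators without signs. *)
Record orientation := Orientation {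
  obasis :> forall d, set V -> 'M[R]_(d, n);
  obasisP : forall p d C, (0 < p)%N -> cells (Xnp p) C -> has_dim1 C d.+1 ->
    direction_basis C (obasis d C);
  obasis_translate : forall p d C c, (0 < p)%N -> cells (Xnp p) C ->
    has_dim1 C d.+1 -> obasis d (translate c C) = obasis d C
}.

Lemma direction_basis_exists d (C : set V) :
  has_dim1 C d.+1 -> exists B : 'M[R]_(d, n), direction_basis C B.
Proof.
move=> [[A [Afree AC]] nopts].
pose a0 : 'rV_n := usubmx (A : 'M_(1 + d, n)).
pose A1 : 'M_(d, n) := dsubmx (A : 'M_(1 + d, n)).
pose B : 'M_(d, n) := A1 - (const_mx 1 : 'cV_d) *m a0.
pose A' : 'M_(1 + d, n + 1) := row_mx A (const_mx 1).
have AE : A = col_mx a0 A1 :> 'M_(1 + d, n) by rewrite vsubmxK.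
have oneE : (const_mx 1 : 'cV[R]_(1 + d)) = col_mx 1%:M (const_mx 1).
  by rewrite -col_mx_const; congr col_mx; apply/rowP=> i; rewrite !ord1 !mxE.
have mulB (w : 'rV_(1 + d)) :
    w *m A - (w *m (const_mx 1 : 'cV_(1 + d))) *m a0 = rsubmx w *m B.
  rewrite -{1 2}[w]hsubmxK AE oneE !mul_row_col mulmx1 mulmxDl mulmxBr mulmxA.
  by rewrite opprD addrACA subrr add0r.
exists B; split.
  apply: inj_row_free => u uB.
  pose w : 'rV_(1 + d) := row_mx (- (u *m (const_mx 1 : 'cV_d))) u.
  have w1 : w *m (const_mx 1 : 'cV_(1 + d)) = 0.
    by rewrite oneE mul_row_col mulmx1 addNr.
  have wA : w *m A = 0.
    by have := mulB w; rewrite w1 mul0mx subr0 row_mxKr uB.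
  have : w *m A' = 0 *m A' by rewrite mul_mx_row wA w1 row_mx0 mul0mx.
  by move=> /(row_free_inj Afree)/(congr1 (@rsubmx R 1 1 d)); rewrite row_mxKr linear0.
have sub_a0 x : C x -> (x - a0 <= B)%MS.
  move=> Cx; pose x' : 'rV_(n + 1) := row_mx x 1%:M.
  have [/submxP[w]|nsub] := boolP (x' <= A')%MS.
    rewrite mul_mx_row => /eq_row_mx[-> w1].
    by rewrite -[X in _ - X]mul1mx w1 mulB submxMl.
  case: nopts; exists (col_mx x A); split.
    have -> : row_mx (col_mx x A) (const_mx 1 : 'cV_(1 + d.+1)) = col_mx x' A'.
      rewrite -[col_mx x' A']block_mxEv block_mxEh; congr row_mx.
      rewrite -col_mx_const; congr col_mx.
      by apply/rowP=> i; rewrite !ord1 !mxE.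
    have rkE : \rank (col_mx x' A') = \rank (x' + A')%MS by rewrite addsmxE.
    rewrite /row_free eqn_leq rank_leq_row /= rkE.
    have le := addsmxSr x' A'; have := mxrank_leqif_sup le.
    rewrite addsmx_sub (negbTE nsub) /= => -[].
    rewrite leq_eqVlt => /orP[->//|].
    by move: Afree => /eqP ->.
  move=> j; case: (splitP (j : 'I_(1 + d.+1))) => i ji.
    suff -> : row j (col_mx x A) = x by [].
    have -> : j = lshift d.+1 i by apply: val_inj.
    transitivity (row i x); first exact: rowKu.
    by apply/rowP=> l; rewrite mxE ord1.
  have -> : j = rshift 1 i by apply: val_inj.
  have -> : row (rshift 1 i) (col_mx x A) = row i A by exact: rowKd.
  exact: AC.
move=> x y Cx Cy; rewrite -[x](subrK a0) -addrA -[a0 - y]opprB.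
by rewrite addmx_sub ?sub_a0 // eqmx_opp sub_a0.
Qed.

Lemma orientation_exists : inhabited orientation.
Proof.
pose o d (C : set V) : 'M[R]_(d, n) := xget 0 [set B | direction_basis C B].
constructor; apply: (@Orientation o) => [p d C _ _ dC|p d C c _ _ _].
  have [B BP] := direction_basis_exists dC.
  by apply: (@xgetPex _ 0 [set B | direction_basis C B]); exists B.
rewrite /o; congr (xget _ _); apply/seteqP.
split=> B /= [Bfree BP]; split=> // x y Cx Cy.
  have := BP (x + exp_vec c) (y + exp_vec c).
  rewrite opprD addrACA subrr addr0; apply; first by exists x.
  by exists y.
move: Cx Cy; rewrite translateE => Cx Cy.
by have := BP _ _ Cx Cy; rewrite opprB addrA subrK.
Qed.

Lemma incidence_translate (o : orientation) p i c G F : (0 < p)%N ->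
  cells (Xnp p) G -> has_dim1 G i -> cells (Xnp p) F -> has_dim1 F i.+1 ->
  incidence o i (translate c G) (translate c F) = incidence o i G F.
Proof.
case: i => //= d p_gt0 cG dG cF dF.
by rewrite outward_translate (obasis_translate o c p_gt0 cG dG)
  (obasis_translate o c p_gt0 cF dF).
Qed.

End Subdivided.

Section ChainMap.
Variables (k : fieldType) (R : realType) (n : nat) (o : orientation R n).
Variables (p q : nat) (c : 'X_{1..n}).
Hypotheses (p_gt0 : (0 < p)%N) (cpq : (mdeg c + p)%N = q).
Local Notation S := {mpoly k[n]}.
Local Notation X := (Xnp R n).
Local Notation free_module r i := {malg S[cell_type (X r) i]}.

Lemma shift_cell_subproof i (F : cell_type (X p) i) :
  cell_of_dim1 (X q) i (translate c (val F)).
Proof.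
have /asboolP[cF dF] := valP F; apply/asboolP; split.
  exact: cell_translate cF.
exact/has_dim1_translate.
Qed.

Definition shift_cell i (F : cell_type (X p) i) : cell_type (X q) i :=
  exist _ (translate c (val F)) (shift_cell_subproof F).

(* The only cell in degree 0 is the empty one, which generates S. *)
Definition chain_map_gen i (F : cell_type (X p) i) : free_module q i :=
  << (if i is 0%N then 'X_[c] else 1 : S) *g shift_cell F >>.

Definition chain_map i : {linear free_module p i -> free_module q i} :=
  lin_ext (@chain_map_gen i).

Lemma chain_mapU i (F : cell_type (X p) i) :
  chain_map i << F >> = chain_map_gen F.
Proof. by rewrite /= lin_extU scale1r. Qed.

Lemma chain_mapP i (u : free_module p i.+1) :
  diff k (X q) o i (chain_map i.+1 u) = chain_map i (diff k (X p) o i u).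
Proof.
pose f1 : {linear _ -> _} := diff k (X q) o i \o chain_map i.+1.
pose f2 : {linear _ -> _} := chain_map i \o diff k (X p) o i.
rewrite -[LHS]/(f1 u) -[RHS]/(f2 u); apply: eq_linear_gen => F {u}.
rewrite /f1 /f2 /= !lin_extU !scale1r /chain_map_gen lin_extU scale1r /diff_gen.
have /asboolP[cF dF] := valP F; have F0 := has_dim1_neq0 dF.
have bij : set_bij (facets F) (facets (shift_cell F)) (@shift_cell i).
  split.
  - by move=> G /= GF; apply/translate_sub.
  - by move=> G H _ _ /(congr1 val)/= /translate_inj /val_inj.
  - move=> G /= GF; have /asboolP[cG dG] := valP G.
    pose G0 : set 'rV[R]_n := [set y | val G (y + exp_vec R c)].
    have G0E : translate c G0 = val G.
      by rewrite translateE; apply/seteqP; split=> y; rewrite /G0 /= subrK.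
    have G0F : G0 `<=` val F by apply/(translate_sub c); rewrite G0E.
    have G0P : cell_of_dim1 (X p) i G0.
      apply/asboolP; split; last by apply/(has_dim1_translate c); rewrite G0E.
      apply: (@cell_untranslate R n p q c) => //; last by rewrite G0E.
      exact: subset_trans (cell_sub p_gt0 cF).
    by exists (exist _ G0 G0P) => //; apply: val_inj.
rewrite (reindex_fsbig _ _ _ _ bij).
have fin : finite_set (facets F).
  apply: (@sub_finite_set _ _ (val @^-1` cells (X p))).
    by move=> G _ /=; have /asboolP[] := valP G.
  by apply: finite_preimage (cells_finite R n p_gt0) => G H _ _ /val_inj.
rewrite !fsbig_finite //= linear_sum /=; apply: eq_bigr => G _.
rewrite lin_extU /chain_map_gen.
have /asboolP[cG dG] := valP G.
rewrite (incidence_translate o c p_gt0 cG dG cF dF).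
rewrite scale_malgU -mulrA; congr (<< _ * _ *g _ >>).
rewrite (face_label_translate p_gt0 cpq cF F0).
clear f1 f2 bij fin; case: i F cF dF F0 G cG dG => [|i] F cF dF F0 G cG dG; last first.
  have G0 := has_dim1_neq0 dG.
  rewrite (face_label_translate p_gt0 cpq cG G0) mulr1.
  by congr 'X_[_]; apply/mnmP=> j; rewrite !mnmBE !mnmDE subnDr.
have -> : val G = set0 by exact: has_dim1_eq0.
by rewrite translate_eq0 !face_label0 !subm0 mpolyXD.
Qed.

Lemma chain_map_im i (x : image_module (diff k (X p) o i)) :
  im_pred (diff k (X q) o i) (chain_map i (val x)).
Proof.
have /asboolP[u <-] := valP x; apply/asboolP.
by exists (chain_map i.+1 u); rewrite chain_mapP.
Qed.

Definition syzygy_map i (x : image_module (diff k (X p) o i)) :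
    image_module (diff k (X q) o i) :=
  exist _ (chain_map i (val x)) (chain_map_im x).

Lemma syzygy_map_is_linear i : linear (@syzygy_map i).
Proof. by move=> a x y; apply: val_inj; rewrite /= !linearP. Qed.

HB.instance Definition _ i := GRing.isLinear.Build S
  (image_module (diff k (X p) o i)) (image_module (diff k (X q) o i)) _
  (@syzygy_map i) (@syzygy_map_is_linear i).

End ChainMap.

Record category := Category {
  ob : Type;
  hom : ob -> ob -> Type;
  idm : forall a, hom a a;
  comp : forall a b c, hom a b -> hom b c -> hom a c;
  comp_idl : forall a b (f : hom a b), comp (idm a) f = f;
  comp_idr : forall a b (f : hom a b), comp f (idm b) = f;
  compA : forall a b c d (f : hom a b) (g : hom b c) (h : hom c d),
    comp f (comp g h) = comp (comp f g) h
}.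
Arguments comp {_ _ _ _} f g.

Record representation (S : nzRingType) (C : category) := Representation {
  rep_ob :> ob C -> lmodType S;
  rep_hom : forall a b, hom a b -> {linear rep_ob a -> rep_ob b};
  rep_id : forall a x, rep_hom (idm a) x = x;
  rep_comp : forall a b c (f : hom a b) (g : hom b c) x,
    rep_hom (comp f g) x = rep_hom g (rep_hom f x)
}.

Section FiniteGeneration.
Variables (S : nzRingType) (C : category) (M : representation S C).

Definition subrepresentation (N : forall a, set (M a)) : Prop :=
  [/\ forall a, N a 0,
      forall a (s : S) (x y : M a), N a x -> N a y -> N a (s *: x + y)
    & forall a b (f : hom a b) (x : M a), N a x -> N b (rep_hom M f x)].

(* The smallest subrepresentation containing E. *)
Definition generated (E : set {a : ob C & M a}) (a : ob C) : set (M a) :=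
  [set x | forall N, subrepresentation N ->
    (forall e, E e -> N (projT1 e) (projT2 e)) -> N a x].

Arguments generated E a : clear implicits.

Definition finitely_generated : Prop :=
  exists E : set {a : ob C & M a},
    finite_set E /\ forall a, generated E a = [set: M a].

End FiniteGeneration.

Section Fm.
Variable n : nat.

(* The object p stands for the resolution F_p, and a morphism is given by the
   monomial by which it multiplies; see chain_map_inj. *)
Definition Fm_ob : Type := {p : nat | (0 < p)%N}.

Definition Fm_hom (p q : Fm_ob) : Type :=
  {c : 'X_{1..n} | (mdeg c + val p == val q)%N}.

Lemma Fm_id_subproof (p : Fm_ob) :
  (mdeg (0%MM : 'X_{1..n}) + val p == val p)%N.
Proof. by rewrite mdeg0. Qed.

Definition Fm_id (p : Fm_ob) : Fm_hom p p := exist _ 0%MM (Fm_id_subproof p).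

Lemma Fm_comp_subproof (p q r : Fm_ob) (c : Fm_hom p q) (d : Fm_hom q r) :
  (mdeg (val d + val c)%MM + val p == val r)%N.
Proof. by rewrite mdegD -addnA (eqP (valP c)) (eqP (valP d)). Qed.

Definition Fm_comp (p q r : Fm_ob) (c : Fm_hom p q) (d : Fm_hom q r) :
  Fm_hom p r := exist _ (val d + val c)%MM (Fm_comp_subproof c d).

Lemma Fm_comp_idl p q (c : Fm_hom p q) : Fm_comp (Fm_id p) c = c.
Proof. by apply: val_inj; rewrite /= addm0. Qed.

Lemma Fm_comp_idr p q (c : Fm_hom p q) : Fm_comp c (Fm_id q) = c.
Proof. by apply: val_inj; rewrite /= add0m. Qed.

Lemma Fm_compA p q r s (c : Fm_hom p q) (d : Fm_hom q r) (e : Fm_hom r s) :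
  Fm_comp c (Fm_comp d e) = Fm_comp (Fm_comp c d) e.
Proof. by apply: val_inj; rewrite /= addmA. Qed.

Definition Fm : category := Category Fm_comp_idl Fm_comp_idr Fm_compA.

End Fm.

Section Syzygy.
Variables (k : fieldType) (R : realType) (n : nat) (o : orientation R n).
Local Notation S := {mpoly k[n]}.

Lemma chain_map_id (p i : nat) (p_gt0 : (0 < p)%N)
    (H : (mdeg (0%MM : 'X_{1..n}) + p)%N = p) :
  chain_map k R p_gt0 H i =1 idfun :> ({malg S[cell_type (Xnp R n p) i]} -> _).
Proof.
apply: eq_linear_gen => F; rewrite /= lin_extU scale1r /chain_map_gen.
have -> : shift_cell p_gt0 H F = F by apply: val_inj; rewrite /= translate0.
by case: i F => [|i] F; rewrite ?mpolyX0.
Qed.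

Lemma chain_map_comp (p q r i : nat) (c d e : 'X_{1..n})
    (p_gt0 : (0 < p)%N) (q_gt0 : (0 < q)%N)
    (Hc : (mdeg c + p)%N = q) (Hd : (mdeg d + q)%N = r)
    (He : (mdeg e + p)%N = r) : e = (d + c)%MM ->
  chain_map k R p_gt0 He i =1
  chain_map k R q_gt0 Hd i \o chain_map k R p_gt0 Hc i
    :> ({malg S[cell_type (Xnp R n p) i]} -> _).
Proof.
move=> eE; apply: eq_linear_gen => F.
rewrite /= !lin_extU !scale1r /chain_map_gen lin_extU /chain_map_gen scale_malgU.
have -> : shift_cell p_gt0 He F = shift_cell q_gt0 Hd (shift_cell p_gt0 Hc F).
  by apply: val_inj; rewrite /= translateD eE.
case: i F => [|i] F; last by rewrite mulr1.
by rewrite eE mpolyXD mulrC.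
Qed.

Lemma mpolyX_inj (c d : 'X_{1..n}) : 'X_[c] = 'X_[d] :> S -> c = d.
Proof.
move=> /(congr1 (mpoly.mcoeff d)); rewrite !mcoeffX eqxx.
by case: eqP => // _ /esym/eqP; rewrite oner_eq0.
Qed.

(* Different monomials give different chain maps. *)
Lemma chain_map_inj (p q : nat) (p_gt0 : (0 < p)%N) (c d : 'X_{1..n})
    (Hc : (mdeg c + p)%N = q) (Hd : (mdeg d + p)%N = q) :
  (chain_map k R p_gt0 Hc 0 =1 chain_map k R p_gt0 Hd 0
    :> ({malg S[cell_type (Xnp R n p) 0]} -> _)) -> c = d.
Proof.
have e0P : cell_of_dim1 (Xnp R n p) 0 set0.
  apply/asboolP; split; first exact: cell0.
  split; last by move=> [A [_ /(_ 0)]].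
  by exists 0; split=> [|[]//]; rewrite /row_free -leqn0 rank_leq_row.
pose e0 : cell_type (Xnp R n p) 0 := exist _ set0 e0P.
move=> eq_cd; have := etrans (esym (chain_mapU k p_gt0 Hc e0))
  (etrans (eq_cd << e0 >>) (chain_mapU k p_gt0 Hd e0)).
rewrite /chain_map_gen.
have -> : shift_cell p_gt0 Hd e0 = shift_cell p_gt0 Hc e0.
  by apply: val_inj; rewrite /= !translate_eq0.
by move=> e; apply: mpolyX_inj; apply: malgU_inj e.
Qed.

Definition syzygy_ob (t : nat) (p : Fm_ob) : lmodType S :=
  image_module (diff k (Xnp R n (val p)) o t).

Definition syzygy_hom (t : nat) (p q : Fm_ob) (c : Fm_hom n p q) :
    {linear syzygy_ob t p -> syzygy_ob t q} :=
  @syzygy_map k R n o _ _ (val c) (valP p) (eqP (valP c)) t.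

Lemma syzygy_id t p x : syzygy_hom t (Fm_id n p) x = x.
Proof. by apply: val_inj; rewrite /= chain_map_id. Qed.

Lemma syzygy_comp t p q r (c : Fm_hom n p q) (d : Fm_hom n q r) x :
  syzygy_hom t (Fm_comp c d) x = syzygy_hom t d (syzygy_hom t c x).
Proof.
apply: val_inj => /=.
exact: (chain_map_comp (valP p) (valP q) (eqP (valP c)) (eqP (valP d))).
Qed.

Definition syzygy (t : nat) : representation S (Fm n) :=
  @Representation S (Fm n) (syzygy_ob t) (@syzygy_hom t)
    (@syzygy_id t) (@syzygy_comp t).

End Syzygy.

(* Main.v *)
(** The module im(d_{t+1}) is spanned by the boundaries of the t-dimensional
    cells, and the chain maps send boundaries of cells to boundaries of the
    translated cells.  So it suffices that, up to translation, only finitely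
    many cells occur.  A nonempty cell C of X_n^q contains a lattice point m,
    and lies in the region y_i >= m_i - 1 since it cannot cross the hyperplane
    y_i = m_i - 1.  Subtracting c = (max(m_i - 1, 0))_i moves C to a cell of
    X_n^p with p = q - |c| <= n. *)
Require Import Defs.
From mathcomp Require Import all_boot all_algebra.
From mathcomp Require Import reals.
From mathcomp Require Import order finmap monalg mpoly.
From mathcomp Require Import boolp classical_sets cardinality.

Set Implicit Arguments.
Unset Strict Implicit.
Unset Printing Implicit Defensive.

Import Order.TTheory GRing.Theory Num.Theory.

Local Open Scope classical_set_scope.
Local Open Scope ring_scope.

Section SmallCells.
Variables (R : realType) (n : nat).

Definition mpred (m : 'X_{1..n}) : 'X_{1..n} := [multinom (m i).-1 | i < n].

Lemma mpred_le m : (mpred m <= m)%MM.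
Proof. by apply/mnm_lepP => i; rewrite mnmE leq_pred. Qed.

Lemma mdegD_mpred m : (mdeg (m - mpred m)%MM + mdeg (mpred m) = mdeg m)%N.
Proof. by rewrite -mdegD submK ?mpred_le. Qed.

(** Every exponent of [m - mpred m] is 0 or 1. *)
Lemma mdeg_sub_mpred m : (mdeg (m - mpred m)%MM <= n)%N.
Proof.
rewrite mdegE -[leqRHS]card_ord -sum1_card leq_sum // => i _.
by rewrite mnmBE mnmE; case: (m i) => //= j; rewrite subSnn.
Qed.

(** Every positive exponent drops by one. This makes the degree [p] of [m - mpred m] positive, as an
    object of the family requires. *)
Lemma mdeg_mpred_lt m : (0 < mdeg m)%N -> (mdeg (mpred m) < mdeg m)%N.
Proof.
move=> m_gt0; rewrite -[ltnRHS]mdegD_mpred -[ltnLHS]add0n ltn_add2r.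
rewrite lt0n mdeg_eq0; apply: contraTneq m_gt0 => mE.
rewrite lt0n negbK mdeg_eq0; apply/eqP/mnmP => i.
have := congr1 (fun c : 'X_{1..n} => c i) mE.
by rewrite mnmBE mnmE !mnm0E; case: (m i) => //= j; rewrite subSnn.
Qed.

Lemma cell_ge_mpred q (C : set 'rV[R]_n) m (y : 'rV[R]_n) : (0 < q)%N ->
  cells (Xnp R n q) C -> C (exp_vec R m) -> C y ->
  forall i, (mpred m i)%:R <= y 0 i.
Proof.
move=> q_gt0 /cellP-/(_ q_gt0)[->//|[s ->]] [_ ms] [[y0 _] ys] i.
rewrite mnmE; have := ms (i, (m i).-1); have := ys (i, (m i).-1); rewrite /= mxE.
(* If [m i = 0], the bound is just nonnegativity on the simplex. Otherwise [m] lies at height 1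
   above the hyperplane, which rules out the sides [Eq] and [Lt]. *)
case: (m i) (y0 i) => [//|j] _ /=; rewrite -natrB // subSnn.
case: (s _) => /= [_ /eqP|_|+ _].
- by rewrite oner_eq0.
- by rewrite ler10.
- by rewrite subr_ge0.
Qed.

Lemma cell_small_translate q (C : set 'rV[R]_n) : (0 < q)%N ->
  cells (Xnp R n q) C -> C !=set0 ->
  exists p c D, [/\ (0 < p <= n)%N, (mdeg c + p)%N = q,
    cells (Xnp R n p) D & C = translate c D].
Proof.
move=> q_gt0 Ccell C0; have [m [Cm degm]] := lattice_point q_gt0 Ccell C0.
pose p := mdeg (m - mpred m)%MM; pose c := mpred m.
have cpq : (mdeg c + p)%N = q by rewrite addnC mdegD_mpred.
have p_gt0 : (0 < p)%N.
  by rewrite -(ltn_add2l (mdeg c)) addn0 cpq -degm mdeg_mpred_lt ?degm.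
pose D : set 'rV[R]_n := [set y | C (y + exp_vec R c)].
have CE : translate c D = C.
  by rewrite translateE; apply/seteqP; split => y; rewrite /D /= subrK.
exists p, c, D; split => //; first by rewrite p_gt0 mdeg_sub_mpred.
apply: (cell_untranslate p_gt0 cpq); last by rewrite CE.
(* [D] lies in [simplex p]: the bound by [mpred m] on [C] keeps the shifted coordinates
   nonnegative. *)
move=> y Dy; rewrite -[y](addrK (exp_vec R c)).
apply/(simplexD cpq); first exact: cell_ge_mpred Ccell Cm Dy.
exact: cell_sub Ccell _ Dy.
Qed.

Lemma finite_cell_type p i : (0 < p)%N -> finite_set [set: cell_type (Xnp R n p) i].
Proof.
move=> p_gt0; apply: (@sub_finite_set _ _ (val @^-1` cells (Xnp R n p))).
  by move=> G _ /=; have /asboolP[] := valP G.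
by apply: finite_preimage (cells_finite R n p_gt0) => G H _ _ /val_inj.
Qed.

End SmallCells.

Section CellBoundaries.
Variables (k : fieldType) (R : realType) (n : nat) (o : orientation R n).
Variable t : nat.
Local Notation X p := (Xnp R n p).

Lemma boundary_im p (F : cell_type (X p) t.+1) :
  im_pred (diff k (X p) o t) (diff k (X p) o t << F >>).
Proof. by apply/asboolP; exists << F >>. Qed.

Definition boundary (p : Fm_ob) (F : cell_type (X (val p)) t.+1) :
  syzygy k o t p :=
  exist (im_pred (diff k (X (val p)) o t)) _ (boundary_im F).

(** No coefficient appears because [F] sits in homological degree [t.+1], while the factor ['X_[c]]
    occurs only in degree 0. *)
Lemma syzygy_boundary (p q : Fm_ob) (c : Fm_hom n p q)
    (F : cell_type (X (val p)) t.+1) :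
  rep_hom (syzygy k o t) c (boundary F) =
  boundary (shift_cell (valP p) (eqP (valP c)) F).
Proof. by apply: val_inj; rewrite /= -chain_mapP chain_mapU. Qed.

Lemma subrepresentation_boundaries (N : forall p, set (syzygy k o t p)) q :
  subrepresentation N -> (forall F, N q (@boundary q F)) ->
  N q = [set: syzygy k o t q].
Proof.
move=> [N0 Nlin _] Nb; apply/seteqP; split => // x _.
have /asboolP[u xE] := valP x.
(* The coordinates of a preimage [u] of [x] in the basis of cells serve as coefficients. *)
suff -> : x = \sum_(F <- monalg.msupp u) monalg.mcoeff F u *: boundary F.
  elim: (monalg.msupp u : seq _) => [|F r IH]; first by rewrite big_nil.
  by rewrite big_cons; apply: Nlin.
apply: val_inj; rewrite -xE {1}[u]monalgE linear_sum.
rewrite [RHS](linear_sum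
  (val : {linear image_module (diff k (X (val q)) o t) -> _})).
apply: eq_bigr => F _.
by rewrite -[monalg.mcoeff F u]mulr1 -scale_malgU linearZ /= mulr1.
Qed.

(** The bound is written [< n.+1] so that the index set is a preimage of the finite set [I_n.+1]. *)
Definition small_boundaries : set {p : ob (Fm n) & syzygy k o t p} :=
  \bigcup_(p in [set p : Fm_ob | (val p < n.+1)%N])
    range (fun F => existT (fun p => syzygy k o t p : Type) p (@boundary p F)).

Lemma finite_small_boundaries : finite_set small_boundaries.
Proof.
apply: bigcup_finite => [|p _]; last exact/finite_image/finite_cell_type/valP.
have -> : [set p : Fm_ob | (val p < n.+1)%N] = val @^-1` `I_n.+1 by [].
by apply: finite_preimage (finite_II _) => p q _ _ /val_inj.
Qed.

Lemma generated_small_boundaries (q : Fm_ob) (F : cell_type (X (val q)) t.+1) :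
  generated small_boundaries (boundary F).
Proof.
have /asboolP[cF dF] := valP F.
(* A cell in degree [t.+1] is never the empty one, so it contains the lattice point that the
   reduction needs. *)
have [p [c [D [/andP[p_gt0 pn] cpq cD FE]]]] :=
  cell_small_translate (valP q) cF (has_dim1_neq0 dF).
have DP : cell_of_dim1 (X p) t.+1 D.
  by apply/asboolP; split => //; apply/(has_dim1_translate c); rewrite -FE.
pose p' : Fm_ob := exist _ p p_gt0; pose D' : cell_type (X p) t.+1 := exist _ D DP.
have cP : (mdeg c + val p' == val q)%N by apply/eqP.
pose c' : Fm_hom n p' q := exist _ c cP.
move=> N [N0 Nlin Nhom] EN.
have -> : F = shift_cell (valP p') (eqP (valP c')) D' by exact: val_inj.
rewrite -syzygy_boundary; apply: Nhom.
by apply: (EN (existT _ p' (@boundary p' D'))); exists p' => //; exists D'.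
Qed.

End CellBoundaries.

Theorem theorem5p7 (k : fieldType) (R : realType) (n : nat)
    (o : orientation R n) (t : nat) :
  finitely_generated (syzygy k o t).
Proof.
exists (@small_boundaries k R n o t); split; first exact: finite_small_boundaries.
move=> q; apply/seteqP; split => // x _ N Nsub EN.
rewrite (subrepresentation_boundaries Nsub) // => F.
exact: generated_small_boundaries.
Qed.
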